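(* Let $\mathbf{C}$ be a category with binary products and terminal object $1$, let $G$ be a group object in $\mathbf{C}$, and let $X$ be a homogeneous object of $\mathbf{C}$ with $G$-action $\rho:G\times X\to X$, the homogeneity being witnessed by a point $x:1\to X$ and an isomorphism $f:G/\mathtt{Stab}_x\to X$. Suppose that $\mathbf{C}(1,p):\mathbf{C}(1,G)\to\mathbf{C}(1,G/\mathtt{Stab}_x)$ is surjective, where $p:G\to G/\mathtt{Stab}_x$ is the quotient map. Then: (1) $\mathbf{C}(1,G)$ acts transitively on $\mathbf{C}(1,X)$, i.e. for all $y,z:1\to X$ there exists $g:1\to G$ such that $z=L^X_g\circ y$. (2) The definition of homogeneous object does not depend on the choice of $x:1\to X$: for every $y:1\to X$ there exists an isomorphism $f_y:G/\mathtt{Stab}_y\to X$ with $f_y\circ\rho'_y=\rho\circ(1\times f_y)$.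
   Context: Group object: $G$ with maps $m:G\times G\to G$, $e:1\to G$, $inv:G\to G$ satisfying the usual group diagrams. A (left) action of $G$ on $X$ is $\rho:G\times X\to X$ with $\rho\circ(m\times1)=\rho\circ(1\times\rho)$ and $\rho\circ(e\times1)=p_2:1\times X\to X$. For $g:1\to G$ the left shift is $L^X_g:X\cong1\times X\xrightarrow{g\times1}G\times X\xrightarrow{\rho}X$, and the right shift on $G$ is $R_g:G\cong G\times1\xrightarrow{1\times g}G\times G\xrightarrow{m}G$. Stabilizer: for a subobject $i:Y\rightarrowtail X$, let $\mathbf{Stab}_Y:\mathbf{C}^{op}\to\mathbf{Set}$ be the subfunctor of $\mathbf{C}(-,G)$ with $z\in\mathbf{Stab}_Y(Z)$ iff there exists $\rho_z:Z\times Y\to Y$ such that $i\circ\rho_z=\rho\circ(z\times i)$. If it is representable, a representing object is denoted $\mathtt{Stab}_Y$; its universal element is a mono $j:\mathtt{Stab}_Y\rightarrowtail G$. For a point $x:1\to X$ (a subobject), write $\mathtt{Stab}_x$. Quotients: for a subgroup $K\rightarrowtail G$ (a subobject closed under $m$, $e$, $inv$), the group $\mathbf{C}(1,K)$ acts from the right on $G$ by $k\mapsto R_k$. In general, given an action (left or right) of an abstract group $H$ on an object $C$ by automorphisms $\sigma(h)$, call $u,v:T\to C$ equivalent if $v=\sigma(h)\circ u$ for some $h\in H$; a quotient map $\pi:C\to C/H$ is an arrow with $\pi u=\pi v$ for all equivalent $u,v$ (any $T$), universal with this property (every arrow from $C$ with this property factors uniquely through $\pi$). $G/K$ denotes the quotient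 of $G$ by $\mathbf{C}(1,K)$, with quotient map $p$. The quotient $G/K$ is universal if for every $C'\in\mathrm{Ob}\,\mathbf{C}$ the map $1\times p:C'\times G\to C'\times G/K$ is a quotient map for the action $k\mapsto1\times R_k$ of $\mathbf{C}(1,K)$ on $C'\times G$. Homogeneous object: an object $X$ with a $G$-action $\rho$ such that for every $x:1\to X$ both $\mathtt{Stab}_x$ (a subgroup of $G$) and $G/\mathtt{Stab}_x$ exist and $G/\mathtt{Stab}_x$ is universal, is homogeneous if for some $x:1\to X$ there is an isomorphism $f:G/\mathtt{Stab}_x\to X$ with $f\circ\rho'_x=\rho\circ(1\times f)$. Here $\rho'_x:G\times(G/\mathtt{Stab}_x)\to G/\mathtt{Stab}_x$ is the unique arrow with $\rho'_x\circ(1\times p_x)=p_x\circ m$, where $p_x:G\to G/\mathtt{Stab}_x$ is the quotient map. *)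

(* Defs.v *)
From Stdlib Require Import ssreflect ClassicalEpsilon.

Set Implicit Arguments.
Unset Strict Implicit.
Unset Printing Implicit Defensive.

Declare Scope cat_scope.
Delimit Scope cat_scope with cat.
Local Open Scope cat_scope.

Reserved Notation "g ∘ f" (at level 40, left associativity).
Reserved Notation "X × Y" (at level 39, left associativity).
Reserved Notation "f ⊠ g" (at level 39, left associativity).
Reserved Notation "⟨ f , g ⟩" (at level 0, format "⟨ f ,  g ⟩").

Record category := Category {
  Ob :> Type;
  Hom : Ob -> Ob -> Type;
  idm : forall X, Hom X X;
  comp : forall X Y Z, Hom Y Z -> Hom X Y -> Hom X Z;
  comp1m : forall X Y (f : Hom X Y), comp (idm Y) f = f;
  compm1 : forall X Y (f : Hom X Y), comp f (idm X) = f;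
  compA : forall W X Y Z (h : Hom Y Z) (g : Hom X Y) (f : Hom W X),
    comp h (comp g f) = comp (comp h g) f }.

Arguments Hom {c} X Y.
Arguments idm {c} X.
Arguments comp {c X Y Z} g f : rename.
Notation "g ∘ f" := (comp g f) : cat_scope.

(* A category with (chosen) binary products and terminal object. *)
Record cartesian := Cartesian {
  cart_cat :> category;
  one : cart_cat;
  bang : forall X : cart_cat, Hom X one;
  bang_uniq : forall (X : cart_cat) (u : Hom X one), u = bang X;
  cprod : cart_cat -> cart_cat -> cart_cat;
  pr1 : forall X Y, Hom (cprod X Y) X;
  pr2 : forall X Y, Hom (cprod X Y) Y;
  cpair : forall Z X Y : cart_cat, Hom Z X -> Hom Z Y -> Hom Z (cprod X Y);
  pr1_cpair : forall (Z X Y : cart_cat) (f : Hom Z X) (g : Hom Z Y),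
    pr1 X Y ∘ cpair f g = f;
  pr2_cpair : forall (Z X Y : cart_cat) (f : Hom Z X) (g : Hom Z Y),
    pr2 X Y ∘ cpair f g = g;
  cpair_uniq : forall (Z X Y : cart_cat) (h : Hom Z (cprod X Y)),
    h = cpair (pr1 X Y ∘ h) (pr2 X Y ∘ h) }.

Arguments one {c}.
Arguments bang {c} X.
Arguments cprod {c} X Y.
Arguments pr1 {c X Y}.
Arguments pr2 {c X Y}.
Arguments cpair {c Z X Y} f g.
Notation "X × Y" := (cprod X Y) : cat_scope.
Notation "⟨ f , g ⟩" := (cpair f g) : cat_scope.

Definition prod_map (C : cartesian) (X X' Y Y' : C)
    (f : Hom X X') (g : Hom Y Y') : Hom (X × Y) (X' × Y') :=
  ⟨ f ∘ pr1, g ∘ pr2 ⟩.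
Notation "f ⊠ g" := (prod_map f g) : cat_scope.

Definition assoc (C : cartesian) (X Y Z : C) :
    Hom ((X × Y) × Z) (X × (Y × Z)) :=
  ⟨ pr1 ∘ pr1, ⟨ pr2 ∘ pr1, pr2 ⟩ ⟩.
Arguments assoc {C} X Y Z.

Definition mono (C : category) (X Y : C) (i : Hom X Y) : Prop :=
  forall (Z : C) (u v : Hom Z X), i ∘ u = i ∘ v -> u = v.

Definition iso (C : category) (X Y : C) (f : Hom X Y) : Prop :=
  exists g : Hom Y X, g ∘ f = idm X /\ f ∘ g = idm Y.

Lemma bang_eq (C : cartesian) (X : C) (u v : Hom X one) : u = v.
Proof. by rewrite (bang_uniq u) (bang_uniq v). Qed.

Lemma cpair_comp (C : cartesian) (W Z X Y : C)
    (f : Hom Z X) (g : Hom Z Y) (h : Hom W Z) :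
  ⟨ f, g ⟩ ∘ h = ⟨ f ∘ h, g ∘ h ⟩.
Proof. by rewrite [LHS]cpair_uniq !compA pr1_cpair pr2_cpair. Qed.

Lemma prod_map_cpair (C : cartesian) (Z X X' Y Y' : C)
    (f : Hom X X') (g : Hom Y Y') (a : Hom Z X) (b : Hom Z Y) :
  f ⊠ g ∘ ⟨ a, b ⟩ = ⟨ f ∘ a, g ∘ b ⟩.
Proof. by rewrite /prod_map cpair_comp -!compA pr1_cpair pr2_cpair. Qed.

Lemma assoc_cpair (C : cartesian) (W X Y Z : C)
    (a : Hom W X) (b : Hom W Y) (c : Hom W Z) :
  assoc X Y Z ∘ ⟨ ⟨ a, b ⟩, c ⟩ = ⟨ a, ⟨ b, c ⟩ ⟩.
Proof.
by rewrite /assoc !cpair_comp -!compA !pr1_cpair !pr2_cpair.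
Qed.

Lemma prod_map_comp (C : cartesian) (X X' X'' Y Y' Y'' : C)
    (f : Hom X X') (f' : Hom X' X'') (g : Hom Y Y') (g' : Hom Y' Y'') :
  (f' ⊠ g') ∘ (f ⊠ g) = (f' ∘ f) ⊠ (g' ∘ g).
Proof. by rewrite [f ⊠ g]/prod_map prod_map_cpair !compA. Qed.

Lemma prod_map1 (C : cartesian) (X Y : C) :
  idm X ⊠ idm Y = idm (X × Y).
Proof. by rewrite [RHS]cpair_uniq !compm1 /prod_map !comp1m. Qed.

Record group_object (C : cartesian) := GroupObject {
  gr_ob :> C;
  gr_m : Hom (gr_ob × gr_ob) gr_ob;
  gr_e : Hom one gr_ob;
  gr_inv : Hom gr_ob gr_ob;
  gr_mA : gr_m ∘ (gr_m ⊠ idm gr_ob)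
          = gr_m ∘ (idm gr_ob ⊠ gr_m) ∘ assoc gr_ob gr_ob gr_ob;
  gr_em : gr_m ∘ (gr_e ⊠ idm gr_ob) = pr2;
  gr_me : gr_m ∘ (idm gr_ob ⊠ gr_e) = pr1;
  gr_invm : gr_m ∘ ⟨ gr_inv, idm gr_ob ⟩ = gr_e ∘ bang gr_ob;
  gr_minv : gr_m ∘ ⟨ idm gr_ob, gr_inv ⟩ = gr_e ∘ bang gr_ob }.

Record left_action (C : cartesian) (G : group_object C) (X : C) := LeftAction {
  act :> Hom (G × X) X;
  act_m : act ∘ (gr_m G ⊠ idm X) = act ∘ (idm G ⊠ act) ∘ assoc G G X;
  act_e : act ∘ (gr_e G ⊠ idm X) = pr2 }.

Definition left_shift (C : cartesian) (G : group_object C) (X : C)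
    (rho : left_action G X) (g : Hom one G) : Hom X X :=
  rho ∘ (g ⊠ idm X) ∘ ⟨ bang X, idm X ⟩.

Definition right_shift (C : cartesian) (G : group_object C)
    (g : Hom one G) : Hom G G :=
  gr_m G ∘ (idm G ⊠ g) ∘ ⟨ idm G, bang G ⟩.

Section GeneralizedElements.
Variables (C : cartesian) (G : group_object C).

Lemma gmulA (Z : C) (f g h : Hom Z G) :
  gr_m G ∘ ⟨ gr_m G ∘ ⟨ f, g ⟩, h ⟩ = gr_m G ∘ ⟨ f, gr_m G ∘ ⟨ g, h ⟩ ⟩.
Proof.
have /= := f_equal (fun u => u ∘ ⟨ ⟨ f, g ⟩, h ⟩) (gr_mA G).
by rewrite -!compA assoc_cpair !prod_map_cpair !comp1m.
Qed.

Lemma gmul1l (Z : C) (f : Hom Z G) : gr_m G ∘ ⟨ gr_e G ∘ bang Z, f ⟩ = f.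
Proof.
have /= := f_equal (fun u => u ∘ ⟨ bang Z, f ⟩) (gr_em G).
by rewrite -compA prod_map_cpair comp1m pr2_cpair.
Qed.

Lemma gmul1r (Z : C) (f : Hom Z G) : gr_m G ∘ ⟨ f, gr_e G ∘ bang Z ⟩ = f.
Proof.
have /= := f_equal (fun u => u ∘ ⟨ f, bang Z ⟩) (gr_me G).
by rewrite -compA prod_map_cpair comp1m pr1_cpair.
Qed.

Lemma gmulVl (Z : C) (f : Hom Z G) :
  gr_m G ∘ ⟨ gr_inv G ∘ f, f ⟩ = gr_e G ∘ bang Z.
Proof.
have /= := f_equal (fun u => u ∘ f) (gr_invm G).
by rewrite -!compA cpair_comp comp1m (bang_uniq (bang G ∘ f)).
Qed.

Lemma gmulVr (Z : C) (f : Hom Z G) :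
  gr_m G ∘ ⟨ f, gr_inv G ∘ f ⟩ = gr_e G ∘ bang Z.
Proof.
have /= := f_equal (fun u => u ∘ f) (gr_minv G).
by rewrite -!compA cpair_comp comp1m (bang_uniq (bang G ∘ f)).
Qed.

Lemma gactM (X : C) (rho : left_action G X) (Z : C)
    (f g : Hom Z G) (t : Hom Z X) :
  rho ∘ ⟨ gr_m G ∘ ⟨ f, g ⟩, t ⟩ = rho ∘ ⟨ f, rho ∘ ⟨ g, t ⟩ ⟩.
Proof.
have /= := f_equal (fun u => u ∘ ⟨ ⟨ f, g ⟩, t ⟩) (act_m rho).
by rewrite -!compA assoc_cpair !prod_map_cpair !comp1m.
Qed.

Lemma gact1 (X : C) (rho : left_action G X) (Z : C) (t : Hom Z X) :
  rho ∘ ⟨ gr_e G ∘ bang Z, t ⟩ = t.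
Proof.
have /= := f_equal (fun u => u ∘ ⟨ bang Z, t ⟩) (act_e rho).
by rewrite -compA prod_map_cpair comp1m pr2_cpair.
Qed.

Lemma left_shiftE (X : C) (rho : left_action G X) (g : Hom one G)
    (Z : C) (t : Hom Z X) :
  left_shift rho g ∘ t = rho ∘ ⟨ g ∘ bang Z, t ⟩.
Proof.
rewrite /left_shift -!compA cpair_comp comp1m prod_map_cpair comp1m.
by rewrite (bang_uniq (bang X ∘ t)).
Qed.

Lemma right_shiftE (g : Hom one G) (Z : C) (t : Hom Z G) :
  right_shift g ∘ t = gr_m G ∘ ⟨ t, g ∘ bang Z ⟩.
Proof.
rewrite /right_shift -!compA cpair_comp comp1m prod_map_cpair comp1m.
by rewrite (bang_uniq (bang G ∘ t)).
Qed.

Lemma right_shift_m (g : Hom one G) :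
  right_shift g ∘ gr_m G = gr_m G ∘ (idm G ⊠ right_shift g).
Proof.
rewrite right_shiftE /prod_map right_shiftE comp1m -gmulA.
by rewrite -(compm1 (gr_m G)) {2}[idm _]cpair_uniq !compm1.
Qed.

Lemma right_shift1 : right_shift (gr_e G) = idm G.
Proof. by rewrite -[LHS]compm1 right_shiftE gmul1r. Qed.

Lemma right_shiftM (g h : Hom one G) :
  right_shift (gr_m G ∘ ⟨ g, h ⟩) = right_shift h ∘ right_shift g.
Proof.
rewrite -[LHS]compm1 -[right_shift g]compm1 !right_shiftE gmulA.
by rewrite -compA cpair_comp.
Qed.

End GeneralizedElements.

Record subobject (C : category) (X : C) := Subobject {
  sub_ob : C;
  sub_arr : Hom sub_ob X;
  sub_mono : mono sub_arr }.

Lemma point_mono (C : cartesian) (X : C) (x : Hom one X) : mono x.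
Proof. by move=> Z u v _; exact: bang_eq. Qed.

Definition point_sub (C : cartesian) (X : C) (x : Hom one X) : subobject X :=
  Subobject (point_mono (x := x)).

(* As the inclusion is monic, the structure arrows of a subgroup are uniquely
   determined; they are recorded only for convenience. *)
Record subgroup (C : cartesian) (G : group_object C) := Subgroup {
  sg_sub :> subobject G;
  sg_m : Hom (sub_ob sg_sub × sub_ob sg_sub) (sub_ob sg_sub);
  sg_e : Hom one (sub_ob sg_sub);
  sg_inv : Hom (sub_ob sg_sub) (sub_ob sg_sub);
  sg_mE : sub_arr sg_sub ∘ sg_m = gr_m G ∘ (sub_arr sg_sub ⊠ sub_arr sg_sub);
  sg_eE : sub_arr sg_sub ∘ sg_e = gr_e G;
  sg_invE : sub_arr sg_sub ∘ sg_inv = gr_inv G ∘ sub_arr sg_sub }.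

(* Subfunctors of the representable functor C(-,G). *)
Record subfunctor (C : category) (G : C) := Subfunctor {
  sf_mem :> forall Z : C, Hom Z G -> Prop;
  sf_comp : forall (Z W : C) (z : Hom Z G) (u : Hom W Z),
    sf_mem z -> sf_mem (z ∘ u) }.

(* [j] is a universal element: u |-> j ∘ u is a (natural) bijection from
   C(Z,S) onto F(Z), for every Z; thus F is represented by S. *)
Definition universal_element (C : category) (G : C) (F : subfunctor G)
    (S : C) (j : Hom S G) : Prop :=
  F S j /\ forall (Z : C) (z : Hom Z G), F Z z -> exists! u : Hom Z S, j ∘ u = z.

Section Stabilizer.
Variables (C : cartesian) (G : group_object C) (X : C) (rho : left_action G X).

Definition in_Stab (Y : subobject X) (Z : C) (z : Hom Z G) : Prop :=
  exists rho_z : Hom (Z × sub_ob Y) (sub_ob Y),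
    sub_arr Y ∘ rho_z = rho ∘ (z ⊠ sub_arr Y).

Lemma in_Stab_comp (Y : subobject X) (Z W : C) (z : Hom Z G) (u : Hom W Z) :
  in_Stab Y z -> in_Stab Y (z ∘ u).
Proof.
case=> r rE; exists (r ∘ (u ⊠ idm _)).
by rewrite compA rE -compA prod_map_comp compm1.
Qed.

Definition Stab (Y : subobject X) : subfunctor G :=
  Subfunctor (@in_Stab_comp Y).

Record stabilizer (Y : subobject X) := Stabilizer {
  stab_ob : C;
  stab_arr : Hom stab_ob G;
  stab_univ : universal_element (Stab Y) stab_arr }.

Lemma stab_mono (Y : subobject X) (S : stabilizer Y) : mono (stab_arr S).
Proof.
move=> Z u v E; have [jS jU] := stab_univ S.
have [w [_ wU]] := jU Z _ (sf_comp u jS).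
by rewrite -(wU u (eq_refl _)) -(wU v (eq_sym E)).
Qed.

Lemma in_Stab_point (x : Hom one X) (Z : C) (z : Hom Z G) :
  in_Stab (point_sub x) z <-> rho ∘ ⟨ z, x ∘ bang Z ⟩ = x ∘ bang Z.
Proof.
split=> [[r /= rE]|E].
  have /= := f_equal (fun u => u ∘ ⟨ idm Z, bang Z ⟩) rE.
  rewrite -!compA prod_map_cpair compm1 => <-.
  by congr (_ ∘ _); exact: bang_eq.
exists (bang _) => /=.
have /= := f_equal (fun u => u ∘ pr1 (X := Z) (Y := one)) E.
rewrite -!compA cpair_comp -!compA /prod_map.
by rewrite (bang_eq (bang Z ∘ pr1) pr2) (bang_eq (bang _) pr2) => ->.
Qed.

Definition stab_factor (Y : subobject X) (S : stabilizer Y)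
    (Z : C) (z : Hom Z G) (zS : in_Stab Y z) :
    {u : Hom Z (stab_ob S) | stab_arr S ∘ u = z} :=
  let: exist _ u uP :=
    constructive_indefinite_description _ (proj2 (stab_univ S) Z z zS) in
  exist _ u (proj1 uP).

End Stabilizer.

Section StabSubgroup.
Variables (C : cartesian) (G : group_object C) (X : C) (rho : left_action G X).
Variables (x : Hom one X) (S : stabilizer rho (point_sub x)).
Let j := stab_arr S.

Lemma stab_arr_fix (Z : C) (u : Hom Z (stab_ob S)) :
  rho ∘ ⟨ j ∘ u, x ∘ bang Z ⟩ = x ∘ bang Z.
Proof.
apply/in_Stab_point; exact: (sf_comp u (proj1 (stab_univ S))).
Qed.

Lemma stab_m_mem : in_Stab rho (point_sub x) (gr_m G ∘ (j ⊠ j)).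
Proof. by apply/in_Stab_point; rewrite gactM !stab_arr_fix. Qed.

Lemma stab_e_mem : in_Stab rho (point_sub x) (gr_e G).
Proof.
apply/in_Stab_point.
by rewrite -[gr_e G]compm1 (bang_eq (idm one) (bang one)) gact1.
Qed.

Lemma stab_inv_mem : in_Stab rho (point_sub x) (gr_inv G ∘ j).
Proof.
apply/in_Stab_point.
have E := stab_arr_fix (idm _); rewrite compm1 in E.
by rewrite -{1}E -gactM gmulVl gact1.
Qed.

Definition stab_subgroup : subgroup G :=
  @Subgroup C G (Subobject (@stab_mono _ _ _ _ _ S)) _ _ _
    (proj2_sig (stab_factor S stab_m_mem))
    (proj2_sig (stab_factor S stab_e_mem))
    (proj2_sig (stab_factor S stab_inv_mem)).

End StabSubgroup.

Record abs_group := AbsGroup {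
  ag_sort :> Type;
  ag_mul : ag_sort -> ag_sort -> ag_sort;
  ag_one : ag_sort;
  ag_inv : ag_sort -> ag_sort;
  ag_mulA : forall a b c, ag_mul a (ag_mul b c) = ag_mul (ag_mul a b) c;
  ag_mul1l : forall a, ag_mul ag_one a = a;
  ag_mul1r : forall a, ag_mul a ag_one = a;
  ag_mulVl : forall a, ag_mul (ag_inv a) a = ag_one;
  ag_mulVr : forall a, ag_mul a (ag_inv a) = ag_one }.

(* A right action; by the two laws every [ra h] is an automorphism. *)
Record right_action (C : category) (H : abs_group) (A : C) := RightAction {
  ra :> H -> Hom A A;
  ra_one : ra (ag_one H) = idm A;
  ra_mul : forall h k, ra (ag_mul h k) = ra k ∘ ra h }.

Definition equivalent (C : category) (H : abs_group) (A : C)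
    (sigma : right_action H A) (T : C) (u v : Hom T A) : Prop :=
  exists h : H, v = sigma h ∘ u.

Definition invariant (C : category) (H : abs_group) (A : C)
    (sigma : right_action H A) (B : C) (q : Hom A B) : Prop :=
  forall (T : C) (u v : Hom T A), equivalent sigma u v -> q ∘ u = q ∘ v.

Definition quotient_map (C : category) (H : abs_group) (A : C)
    (sigma : right_action H A) (Q : C) (pi : Hom A Q) : Prop :=
  invariant sigma pi /\
  forall (B : C) (q : Hom A B), invariant sigma q ->
    exists! q' : Hom Q B, q' ∘ pi = q.

Section SubgroupPoints.
Variables (C : cartesian) (G : group_object C) (K : subgroup G).

Let kmul (k l : Hom one (sub_ob K)) := sg_m K ∘ ⟨ k, l ⟩.
Let kinv (k : Hom one (sub_ob K)) := sg_inv K ∘ k.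

Lemma sub_arr_mul (k l : Hom one (sub_ob K)) :
  sub_arr K ∘ (sg_m K ∘ ⟨ k, l ⟩) = gr_m G ∘ ⟨ sub_arr K ∘ k, sub_arr K ∘ l ⟩.
Proof. by rewrite compA sg_mE -compA prod_map_cpair. Qed.

Lemma sub_arr_inv (k : Hom one (sub_ob K)) :
  sub_arr K ∘ (sg_inv K ∘ k) = gr_inv G ∘ (sub_arr K ∘ k).
Proof. by rewrite compA sg_invE compA. Qed.

Let e_bang : gr_e G = gr_e G ∘ bang one.
Proof. by rewrite (bang_eq (bang one) (idm one)) compm1. Qed.

Lemma points_mulA a b c : kmul a (kmul b c) = kmul (kmul a b) c.
Proof. by apply: (sub_mono (s := K)); rewrite !sub_arr_mul gmulA. Qed.

Lemma points_mul1l a : kmul (sg_e K) a = a.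
Proof.
by apply: (sub_mono (s := K)); rewrite !sub_arr_mul sg_eE e_bang gmul1l.
Qed.

Lemma points_mul1r a : kmul a (sg_e K) = a.
Proof.
by apply: (sub_mono (s := K)); rewrite !sub_arr_mul sg_eE e_bang gmul1r.
Qed.

Lemma points_mulVl a : kmul (kinv a) a = sg_e K.
Proof.
apply: (sub_mono (s := K)).
by rewrite !sub_arr_mul sub_arr_inv gmulVl sg_eE -e_bang.
Qed.

Lemma points_mulVr a : kmul a (kinv a) = sg_e K.
Proof.
apply: (sub_mono (s := K)).
by rewrite !sub_arr_mul sub_arr_inv gmulVr sg_eE -e_bang.
Qed.

(* The group C(1,K). *)
Definition points_group : abs_group :=
  AbsGroup points_mulA points_mul1l points_mul1r points_mulVl points_mulVr.

Lemma shift_one : right_shift (sub_arr K ∘ sg_e K) = idm G.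
Proof. by rewrite sg_eE right_shift1. Qed.

Lemma shift_mul (k l : points_group) :
  right_shift (sub_arr K ∘ ag_mul k l)
  = right_shift (sub_arr K ∘ l) ∘ right_shift (sub_arr K ∘ k).
Proof. by rewrite /= /kmul sub_arr_mul right_shiftM. Qed.

Definition shift_action : right_action points_group (gr_ob G) :=
  @RightAction C points_group G
    (fun k : Hom one (sub_ob K) => right_shift (sub_arr K ∘ k))
    shift_one shift_mul.

Lemma prod_shift_one (C' : C) : idm C' ⊠ shift_action (ag_one _) = idm (C' × G).
Proof. by rewrite ra_one prod_map1. Qed.

Lemma prod_shift_mul (C' : C) (k l : points_group) :
  idm C' ⊠ shift_action (ag_mul k l)
  = (idm C' ⊠ shift_action l) ∘ (idm C' ⊠ shift_action k).
Proof. by rewrite ra_mul prod_map_comp comp1m. Qed.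

Definition prod_shift_action (C' : C) : right_action points_group (C' × G) :=
  @RightAction C points_group (C' × G)
    (fun k => idm C' ⊠ shift_action k) (prod_shift_one C') (@prod_shift_mul C').

Record quotient := Quotient {
  quot_ob : C;
  quot_map : Hom G quot_ob;
  quot_mapP : quotient_map shift_action quot_map }.

Definition universal_quotient (Q : quotient) : Prop :=
  forall C' : C, quotient_map (prod_shift_action C') (idm C' ⊠ quot_map Q).

Lemma quot_map_m_invariant (Q : quotient) :
  invariant (prod_shift_action G) (quot_map Q ∘ gr_m G).
Proof.
move=> T u v [k ->] /=.
have -> : quot_map Q ∘ gr_m G ∘ (idm G ⊠ right_shift (sub_arr K ∘ k) ∘ u)
        = quot_map Q ∘ (right_shift (sub_arr K ∘ k) ∘ (gr_m G ∘ u)).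
  by rewrite -(compA (quot_map Q)) [gr_m G ∘ (_ ∘ u)]compA -right_shift_m -compA.
rewrite -compA; apply: (proj1 (quot_mapP Q)); by exists k.
Qed.

End SubgroupPoints.

(* A choice of Stab_x and of a universal quotient G/Stab_x for each point x. *)
Record stab_quotients (C : cartesian) (G : group_object C) (X : C)
    (rho : left_action G X) := StabQuotients {
  sq_stab : forall x : Hom one X, stabilizer rho (point_sub x);
  sq_quot : forall x : Hom one X, quotient (stab_subgroup (sq_stab x));
  sq_univ : forall x : Hom one X, universal_quotient (sq_quot x) }.

Section Homogeneous.
Variables (C : cartesian) (G : group_object C) (X : C) (rho : left_action G X).
Variable (E : stab_quotients rho).

Definition coset_ob (x : Hom one X) : C := quot_ob (sq_quot E x).

Definition coset_map (x : Hom one X) : Hom G (coset_ob x) :=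
  quot_map (sq_quot E x).

Lemma coset_act_exists_unique (x : Hom one X) :
  exists! r : Hom (G × coset_ob x) (coset_ob x),
    r ∘ (idm G ⊠ coset_map x) = coset_map x ∘ gr_m G.
Proof.
exact: (proj2 (sq_univ E x G) _ _ (@quot_map_m_invariant _ _ _ (sq_quot E x))).
Qed.

Definition coset_act (x : Hom one X) : Hom (G × coset_ob x) (coset_ob x) :=
  proj1_sig (constructive_indefinite_description _ (coset_act_exists_unique x)).

Lemma coset_actE (x : Hom one X) :
  coset_act x ∘ (idm G ⊠ coset_map x) = coset_map x ∘ gr_m G.
Proof.
by rewrite /coset_act; case: constructive_indefinite_description => r [].
Qed.

Definition homogeneity_witness (x : Hom one X) (f : Hom (coset_ob x) X) : Prop :=
  iso f /\ f ∘ coset_act x = rho ∘ (idm G ⊠ f).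

End Homogeneous.

Arguments homogeneity_witness {C G X rho} E x f.

(* Main.v *)
(** By equivariance [f ∘ p] is the orbit map of the point [x0 = f ∘ p ∘ e]
    (which need not be [x]), so surjectivity of [C(1,p)] makes every point of
    [X] a translate of [x0]; this gives transitivity.  If [y = h·x], then
    conjugation by [h] carries the points of [Stab_y] to those of [Stab_x], so
    right translation [R_h] descends to an equivariant isomorphism
    [G/Stab_y -> G/Stab_x], which is composed with [f]. *)

From Stdlib Require Import ssreflect.
Require Import Defs.
Local Open Scope cat_scope.

Set Implicit Arguments.
Unset Strict Implicit.
Unset Printing Implicit Defensive.

Lemma comp_bang_one (C : cartesian) (A : C) (a : Hom one A) : a ∘ bang one = a.
Proof. by rewrite (bang_eq (bang one) (idm one)) compm1. Qed.

Lemma left_shift_point (C : cartesian) (G : group_object C) (X : C)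
    (rho : left_action G X) (g : Hom one G) (x : Hom one X) :
  left_shift rho g ∘ x = rho ∘ ⟨ g, x ⟩.
Proof. by rewrite left_shiftE comp_bang_one. Qed.

(** Any arrow of the form [u ∘ pi] is invariant, so uniqueness of its factorization through [pi]
    makes [pi] epi. *)
Lemma quotient_map_epi (C : category) (H : abs_group) (A : C)
    (sigma : right_action H A) (Q B : C) (pi : Hom A Q) (u v : Hom Q B) :
  quotient_map sigma pi -> u ∘ pi = v ∘ pi -> u = v.
Proof.
move=> [piI piU] E.
have [|w [_ wU]] := piU B (u ∘ pi).
  by move=> T a b ab; rewrite -!compA (piI T a b ab).
by rewrite -(wU u (eq_refl _)) -(wU v (eq_sym E)).
Qed.

Section PointTranslation.
Variables (C : cartesian) (G : group_object C) (X : C) (rho : left_action G X).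

Lemma gmul_mulVr (g h : Hom one G) :
  gr_m G ∘ ⟨ g, gr_m G ∘ ⟨ gr_inv G ∘ g, h ⟩ ⟩ = h.
Proof. by rewrite -gmulA gmulVr gmul1l. Qed.

Lemma gact_Vl (g : Hom one G) (x y : Hom one X) :
  rho ∘ ⟨ g, x ⟩ = y -> rho ∘ ⟨ gr_inv G ∘ g, y ⟩ = x.
Proof. by move=> <-; rewrite -gactM gmulVl gact1. Qed.

(** $h^{-1}zh$ sends $x$ to $y$, keeps $y$ fixed by $z$, and returns to $x$. *)
Lemma in_Stab_conj (h z : Hom one G) (x y : Hom one X) :
  rho ∘ ⟨ h, x ⟩ = y -> in_Stab rho (point_sub y) z ->
  in_Stab rho (point_sub x) (gr_m G ∘ ⟨ gr_inv G ∘ h, gr_m G ∘ ⟨ z, h ⟩ ⟩).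
Proof.
move=> hx /in_Stab_point; rewrite comp_bang_one => zy.
apply/in_Stab_point; rewrite comp_bang_one !gactM hx zy.
exact: gact_Vl.
Qed.

Lemma right_shiftV (h : Hom one G) :
  right_shift (gr_inv G ∘ h) ∘ right_shift h = idm G.
Proof. by rewrite -right_shiftM gmulVr comp_bang_one right_shift1. Qed.

Lemma right_shiftVr (h : Hom one G) :
  right_shift h ∘ right_shift (gr_inv G ∘ h) = idm G.
Proof. by rewrite -right_shiftM gmulVl comp_bang_one right_shift1. Qed.

Variable E : stab_quotients rho.

Lemma coset_map_epi (x : Hom one X) (B : C) (u v : Hom (coset_ob E x) B) :
  u ∘ coset_map E x = v ∘ coset_map E x -> u = v.
Proof. exact: (quotient_map_epi (quot_mapP (sq_quot E x))). Qed.

(** Such a [k] factors through the stabilizer, so [right_shift k] is one of the automorphisms that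
    the quotient map identifies with the identity. *)
Lemma coset_map_right_shift (x : Hom one X) (k : Hom one G) :
  in_Stab rho (point_sub x) k ->
  coset_map E x ∘ right_shift k = coset_map E x.
Proof.
move=> /(stab_factor (sq_stab E x)) [u <-].
rewrite -[RHS]compm1.
symmetry; apply: (proj1 (quot_mapP (sq_quot E x))).
by exists u; rewrite compm1.
Qed.

Lemma coset_translate (h : Hom one G) (x y : Hom one X) :
  rho ∘ ⟨ h, x ⟩ = y ->
  exists phi : Hom (coset_ob E y) (coset_ob E x),
    phi ∘ coset_map E y = coset_map E x ∘ right_shift h.
Proof.
move=> hx.
have [|phi [phiE _]] :=
  proj2 (quot_mapP (sq_quot E y)) _ (coset_map E x ∘ right_shift h);
  last by exists phi.
move=> T u v [k ->] /=.
set z := stab_arr _ ∘ k.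
have zy : in_Stab rho (point_sub y) z.
  exact: (sf_comp k (proj1 (stab_univ (sq_stab E y)))).
(* Since $h(h^{-1}zh) = zh$, one has $p_x R_h = p_x R_{h^{-1}zh} R_h = p_x R_{zh} = p_x R_h R_z$. *)
rewrite -{1}(coset_map_right_shift (in_Stab_conj hx zy)).
rewrite -(compA (coset_map E x)) -right_shiftM gmul_mulVr right_shiftM.
by rewrite !compA.
Qed.

Lemma coset_translate_iso (h : Hom one G) (x y : Hom one X) :
  rho ∘ ⟨ h, x ⟩ = y ->
  exists2 phi : Hom (coset_ob E y) (coset_ob E x),
    iso phi & phi ∘ coset_act E y = coset_act E x ∘ (idm G ⊠ phi).
Proof.
move=> hx.
have [phi phiE] := coset_translate hx.
(* The inverse is the descent of right translation by $h^{-1}$, which carries $y$ back to $x$. *)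
have [psi psiE] := coset_translate (gact_Vl hx).
exists phi.
  exists psi; split; apply: coset_map_epi; rewrite comp1m -compA.
    by rewrite phiE compA psiE -compA right_shiftV compm1.
  by rewrite psiE compA phiE -compA right_shiftVr compm1.
(* Universality of $G/\mathtt{Stab}_y$ makes $1\times p_y$ epi. After precomposing with it,
   equivariance reduces to right shifts commuting with left multiplication. *)
apply: (quotient_map_epi (sq_univ E y G)).
rewrite -!compA -/(coset_map E y) coset_actE prod_map_comp phiE comp1m compA.
rewrite phiE -compA right_shift_m compA -coset_actE -compA prod_map_comp.
by rewrite comp1m.
Qed.

(** Write $g = ge$ and use equivariance first of the quotient map, then of [f]. *)
Lemma witness_orbit_map (x : Hom one X) (f : Hom (coset_ob E x) X)
    (g : Hom one G) :
  homogeneity_witness E x f ->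
  f ∘ (coset_map E x ∘ g) = rho ∘ ⟨ g, f ∘ (coset_map E x ∘ gr_e G) ⟩.
Proof.
move=> [_ fE].
rewrite -{1}(gmul1r g) comp_bang_one !(compA (coset_map E x)) -coset_actE.
by rewrite -compA prod_map_cpair comp1m compA fE -compA prod_map_cpair comp1m.
Qed.

Lemma witness_transitive (x : Hom one X) (f : Hom (coset_ob E x) X) :
  homogeneity_witness E x f ->
  (forall q : Hom one (coset_ob E x),
     exists g : Hom one G, coset_map E x ∘ g = q) ->
  forall y z : Hom one X, exists g : Hom one G, rho ∘ ⟨ g, y ⟩ = z.
Proof.
move=> hf hp.
have [[f' [_ ff']] _] := hf.
have orb y : exists g, rho ∘ ⟨ g, f ∘ (coset_map E x ∘ gr_e G) ⟩ = y.
  (* Lift along the quotient map the point of the coset object that [f] sends to [y]. *)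
  have [g gE] := hp (f' ∘ y); exists g.
  by rewrite -witness_orbit_map // gE compA ff' comp1m.
move=> y z; have [a ay] := orb y; have [b bz] := orb z.
(* $ba^{-1}$ moves [y] back to the base point of the orbit map, then on to [z]. *)
by exists (gr_m G ∘ ⟨ b, gr_inv G ∘ a ⟩); rewrite gactM (gact_Vl ay).
Qed.

Lemma witness_translate (x y : Hom one X) (h : Hom one G)
    (f : Hom (coset_ob E x) X) :
  rho ∘ ⟨ h, x ⟩ = y -> homogeneity_witness E x f ->
  exists fy : Hom (coset_ob E y) X, homogeneity_witness E y fy.
Proof.
move=> hx [[f' [f'f ff']] fE].
have [phi [psi [psiphi phipsi]] phiE] := coset_translate_iso hx.
exists (f ∘ phi); split.
  exists (psi ∘ f'); split.
    by rewrite -compA (compA f') f'f comp1m.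
  by rewrite -compA (compA phi) phipsi comp1m.
by rewrite -compA phiE compA fE -compA prod_map_comp comp1m.
Qed.

End PointTranslation.

Theorem proposition8p2p4 (C : cartesian) (G : group_object C) (X : C)
    (rho : left_action G X) (E : stab_quotients rho)
    (x : Hom one X) (f : Hom (coset_ob E x) X)
    (hf : homogeneity_witness E x f)
    (hp : forall q : Hom one (coset_ob E x),
            exists g : Hom one G, coset_map E x ∘ g = q) :
  (forall y z : Hom one X, exists g : Hom one G, z = left_shift rho g ∘ y) /\
  (forall y : Hom one X, exists fy : Hom (coset_ob E y) X,
     homogeneity_witness E y fy).
Proof.
have trans := witness_transitive hf hp.
split=> [y z|y].
  by have [g gE] := trans y z; exists g; rewrite left_shift_point.
by have [h hx] := trans x y; exact: (witness_translate hx hf).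
Qed.
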